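(* Let $j\ge1$ and $\Upsilon\subseteq S_j$. Define $\Upsilon_0=\{(\tau,0^j):\tau\in\Upsilon\}$, $\Upsilon_{\mathrm{inc}}=\{(\tau,\,0~1\cdots(j-1)):\tau\in\Upsilon\}$, and $\Upsilon_{d}=\{(\tau,u):\tau\in\Upsilon,\ u\in D_j\}$, where $D_j$ is the set of all words of length $j$ that are rearrangements of $0,1,\dots,j-1$. Let $\Gamma_1=\Upsilon_0\cup\{(1\text{-}2,0~1),(1\text{-}2,1~0),(2\text{-}1,0~1),(2\text{-}1,1~0)\}$, $\Gamma_2=\Upsilon_{\mathrm{inc}}\cup\{(1\text{-}2,1~0),(1\text{-}2,0~0),(2\text{-}1,1~0),(2\text{-}1,0~0)\}$, $\Gamma_3=\Upsilon_d\cup\{(1\text{-}2,0~0),(2\text{-}1,0~0)\}$. Then for all $k\ge1$ and all $n\ge1$: (1) $Av_{n,k}^{\Gamma_1}=k\,Av_n^{\Upsilon}$; (2) $Av_{n,k}^{\Gamma_2}=\binom{k}{n}Av_n^{\Upsilon}$; (3) $Av_{n,k}^{\Gamma_3}=\binom{k}{n}\,n!\,Av_n^{\Upsilon}$.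
   Context: For integers $k\ge1$, $n\ge0$, $C_k\wr S_n$ denotes the set of pairs $(\sigma,w)$ where $\sigma=\sigma_1\cdots\sigma_n$ is a permutation of $\{1,\dots,n\}$ in one-line notation and $w=w_1\cdots w_n\in\{0,1,\dots,k-1\}^n$. For a sequence of distinct integers, $\mathrm{red}$ replaces the $i$-th smallest entry by $i$; for a word over nonnegative integers, $\mathrm{red}$ replaces every occurrence of the $i$-th smallest distinct letter by $i-1$. A pattern $(\tau,u)$ has $\tau\in S_m$ and $u$ a word of length $m$ with $\mathrm{red}(u)=u$; e.g. $(2\text{-}1,1~0)$ means $\tau=21$, $u=10$. $(\tau,u)$ bi-occurs in $(\sigma,w)$ if there are $1\le i_1<\cdots<i_m\le n$ (not necessarily adjacent) with $\mathrm{red}(\sigma_{i_1}\cdots\sigma_{i_m})=\tau$ and $\mathrm{red}(w_{i_1}\cdots w_{i_m})=u$; $(\sigma,w)$ bi-avoids a set of patterns if no member bi-occurs in it. $Av_{n,k}^{\Gamma}$ is the number of elements of $C_k\wr S_n$ bi-avoiding $\Gamma$. A permutation $\sigma\in S_n$ avoids $\Upsilon$ if there are no indices $i_1<\cdots<i_j$ with $\mathrm{red}(\sigma_{i_1}\cdots\sigma_{i_j})\in\Upsilon$; $Av_n^{\Upsilon}$ is the number of such $\sigma\in S_n$. Here $\binom{k}{n}=0$ if $n>k$. *)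

(* Defs.v *)
From mathcomp Require Import all_boot all_fingroup.

Set Implicit Arguments.
Unset Strict Implicit.
Unset Printing Implicit Defensive.

(* Reduction of a sequence of distinct integers (the i-th smallest entry becomes
   i, counting from 1) and of a word with repetitions allowed (the i-th smallest
   distinct letter becomes i - 1). *)
Definition red_perm (s : seq nat) : seq nat :=
  [seq count (fun y => y <= x) s | x <- s].

Definition red_word (s : seq nat) : seq nat :=
  [seq count (fun y => y < x) (undup s) | x <- s].

(* MathComp permutations act on {0, ..., n-1}; the letters and the one-line
   notation are shifted so as to range over {1, ..., n}. *)
Definition letter n (s : 'S_n) (i : 'I_n) : nat := (s i).+1.

Definition oneline n (s : 'S_n) : seq nat := [seq letter s i | i <- enum 'I_n].

(* The underlying set of the wreath product of C_k by S_n. *)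
Definition colored_perm (k n : nat) : finType := ('S_n * n.-tuple 'I_k)%type.

(* A pattern (tau, u), with tau in one-line notation. *)
Definition pattern : Type := (seq nat * seq nat)%type.

Definition is_pattern (p : pattern) : bool :=
  [&& perm_eq p.1 (iota 1 (size p.1)), size p.2 == size p.1
    & red_word p.2 == p.2].

Definition increasing m n (i : m.-tuple 'I_n) : bool :=
  sorted ltn [seq val x | x <- i].

Definition bi_occurs k n (p : pattern) (x : colored_perm k n) : bool :=
  [exists i : (size p.1).-tuple 'I_n,
    [&& increasing i,
        red_perm [seq letter x.1 l | l <- i] == p.1
      & red_word [seq val (tnth x.2 l) | l <- i] == p.2]].

(* Finite sets of patterns are given by sequences; only membership matters. *)
Definition bi_avoids k n (G : seq pattern) (x : colored_perm k n) : bool :=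
  all (fun p => ~~ bi_occurs p x) G.

Definition Av_col (n k : nat) (G : seq pattern) : nat :=
  #|[set x : colored_perm k n | bi_avoids G x]|.

Definition avoids j n (U : {set 'S_j}) (s : 'S_n) : bool :=
  ~~ [exists i : j.-tuple 'I_n,
       increasing i &&
       (red_perm [seq letter s l | l <- i] \in [seq oneline t | t in U])].

Definition Av_perm (n j : nat) (U : {set 'S_j}) : nat :=
  #|[set s : 'S_n | avoids U s]|.

Definition lift_zero j (U : {set 'S_j}) : seq pattern :=
  [seq (oneline t, nseq j 0) | t in U].

Definition lift_inc j (U : {set 'S_j}) : seq pattern :=
  [seq (oneline t, iota 0 j) | t in U].

Definition lift_distinct j (U : {set 'S_j}) : seq pattern :=
  [seq (oneline t, u) | t <- enum U, u <- permutations (iota 0 j)].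

Definition Gamma1 j (U : {set 'S_j}) : seq pattern :=
  lift_zero U ++
  [:: ([:: 1; 2], [:: 0; 1]); ([:: 1; 2], [:: 1; 0]);
      ([:: 2; 1], [:: 0; 1]); ([:: 2; 1], [:: 1; 0])].

Definition Gamma2 j (U : {set 'S_j}) : seq pattern :=
  lift_inc U ++
  [:: ([:: 1; 2], [:: 1; 0]); ([:: 1; 2], [:: 0; 0]);
      ([:: 2; 1], [:: 1; 0]); ([:: 2; 1], [:: 0; 0])].

Definition Gamma3 j (U : {set 'S_j}) : seq pattern :=
  lift_distinct U ++
  [:: ([:: 1; 2], [:: 0; 0]); ([:: 2; 1], [:: 0; 0])].

(* All patterns above are well formed: the first component is a permutation and
   the second a reduced word of the same length. *)
Lemma size_oneline n (s : 'S_n) : size (oneline s) = n.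
Proof. by rewrite size_map size_enum_ord. Qed.

Lemma perm_oneline n (s : 'S_n) :
  perm_eq (oneline s) (iota 1 (size (oneline s))).
Proof.
rewrite size_oneline; apply: uniq_perm; rewrite ?iota_uniq //.
  rewrite map_inj_uniq ?enum_uniq // => a b [/val_inj]; exact: perm_inj.
move=> x; rewrite mem_iota add1n ltnS; apply/mapP/idP => [[i _ ->]|].
  by rewrite /letter /= ltn_ord.
case: x => // x /andP[_ xn]; exists ((s^-1)%g (Ordinal xn)).
  by rewrite mem_enum.
by rewrite /letter permKV.
Qed.

Lemma red_word_nseq j : red_word (nseq j 0) = nseq j 0.
Proof.
apply: (@eq_from_nth _ 0); rewrite size_map // size_nseq => i ij.
rewrite (nth_map 0) ?size_nseq // nth_nseq ij.
by rewrite (eq_count (a2 := pred0)) ?count_pred0.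
Qed.

Lemma red_word_rearrangement j (u : seq nat) :
  perm_eq u (iota 0 j) -> red_word u = u.
Proof.
move=> uj; have uu : uniq u by rewrite (perm_uniq uj) iota_uniq.
rewrite /red_word undup_id // -[RHS]map_id; apply/eq_in_map => x.
rewrite (perm_mem uj) mem_iota add0n => /andP[_ xj].
rewrite (seq.permP uj) -(subnKC (ltnW xj)) iotaD count_cat.
have -> : count (fun y => y < x) (iota 0 x) = size (iota 0 x).
  by apply/eqP; rewrite -all_count; apply/allP => y; rewrite mem_iota.
rewrite size_iota add0n; suff -> : count (fun y => y < x) (iota x (j - x)) = 0.
  by rewrite addn0.
apply/eqP; rewrite -leqn0 leqNgt -has_count -all_predC.
by apply/allP => y; rewrite mem_iota /= -leqNgt => /andP[].
Qed.

Lemma Gamma1_patterns j (U : {set 'S_j}) : all is_pattern (Gamma1 U).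
Proof.
rewrite all_cat; apply/andP; split=> //.
apply/allP => _ /imageP[t _ ->]; rewrite /is_pattern perm_oneline.
by rewrite size_nseq size_oneline red_word_nseq !eqxx.
Qed.

Lemma Gamma2_patterns j (U : {set 'S_j}) : all is_pattern (Gamma2 U).
Proof.
rewrite all_cat; apply/andP; split=> //.
apply/allP => _ /imageP[t _ ->]; rewrite /is_pattern perm_oneline.
by rewrite size_iota size_oneline (@red_word_rearrangement j) ?eqxx.
Qed.

Lemma Gamma3_patterns j (U : {set 'S_j}) : all is_pattern (Gamma3 U).
Proof.
rewrite all_cat; apply/andP; split=> //.
apply/allP => p /allpairsP[[t u] /= [_]]; rewrite mem_permutations => uj ->.
rewrite /is_pattern perm_oneline /= (perm_size uj) size_iota size_oneline.
by rewrite (red_word_rearrangement uj) !eqxx.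
Qed.

(* Main.v *)
(* Every pair of entries of a permutation reduces to 12 or 21, so forbidding a
   set of two-letter words under both permutations 12 and 21 constrains the word
   w alone: it must be constant, strictly increasing, or duplicate-free,
   respectively.  In each case the reductions of the length-j subwords of such a
   w all belong to the set of words carried by the lifts of U, so avoiding the
   lifts amounts to sigma avoiding U, and the pairs (sigma, w) are counted by
   a product. *)

Require Import Defs.
From mathcomp Require Import all_boot all_fingroup.

Set Implicit Arguments.
Unset Strict Implicit.
Unset Printing Implicit Defensive.

Lemma tnth_pairwiseP (T : Type) (e : rel T) n (t : n.-tuple T) :
  reflect (forall a b : 'I_n, a < b -> e (tnth t a) (tnth t b)) (pairwise e t).
Proof.
(* [pairwiseP] asks for a default element; a nonempty tuple supplies [thead t], and the empty one is
   settled apart. *)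
case: n t => [|n] t; first by rewrite tuple0; constructor; case.
apply: (iffP (pairwiseP (thead t))) => [te a b ab | te a b].
  by rewrite !(tnth_nth (thead t)) te // inE size_tuple.
rewrite !inE size_tuple => an bn ab.
by have := te (Ordinal an) (Ordinal bn) ab; rewrite !(tnth_nth (thead t)).
Qed.

Lemma increasing_pairwise n (i : seq 'I_n) :
  sorted ltn [seq val x | x <- i] = pairwise (relpre val ltn) i.
Proof. by rewrite (sorted_pairwise ltn_trans) pairwise_map. Qed.

Lemma pairwise_subword (T : Type) (e : rel T) n (t : n.-tuple T)
    (i : seq 'I_n) :
    sorted ltn [seq val x | x <- i] -> pairwise e t ->
  pairwise e [seq tnth t l | l <- i].
Proof.
rewrite increasing_pairwise pairwise_map => i_inc /tnth_pairwiseP te.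
exact: sub_pairwise i_inc.
Qed.

Lemma size_red_perm s : size (red_perm s) = size s.
Proof. exact: size_map. Qed.

Lemma red_perm_pair x y :
  x != y -> red_perm [:: x; y] = if x < y then [:: 1; 2] else [:: 2; 1].
Proof. by rewrite /red_perm /= !leqnn; case: (ltngtP x y). Qed.

Lemma red_word_pair x y :
  red_word [:: x; y] =
    if x == y then [:: 0; 0] else if x < y then [:: 0; 1] else [:: 1; 0].
Proof.
rewrite /red_word /= inE; case: (ltngtP x y) => /= [xy | yx | ->].
- by rewrite !ltnn xy ltnNge ltnW.
- by rewrite !ltnn yx ltnNge ltnW.
by rewrite ltnn.
Qed.

Lemma pairwise_eq_nseq (T : eqType) (x : T) s :
  pairwise eq_op (x :: s) -> x :: s = nseq (size s).+1 x.
Proof.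
move=> /andP[xs _]; congr (_ :: _); apply/all_pred1P.
by apply: sub_all xs => y /=; rewrite eq_sym.
Qed.

Lemma red_word_const j s :
  size s = j -> pairwise eq_op s -> red_word s = nseq j 0.
Proof.
move=> <-; case: s => // x s /pairwise_eq_nseq->.
rewrite /red_word map_nseq size_nseq; congr nseq; apply/eqP; rewrite -leqn0 leqNgt -has_count.
by apply/hasPn => y; rewrite mem_undup mem_nseq => /eqP->; rewrite ltnn.
Qed.

(** For [x < y] in [s], every letter below [x] is below [y], and [x] itself is below [y] only. Hence
    reduction preserves strict order. *)
Lemma count_ltn_mono (s : seq nat) :
  {in s &, {mono (fun x => count (fun y => y < x) s) : x y / x < y}}.
Proof.
have lt_count x y : x \in s -> x < y ->
    count (fun z => z < x) s < count (fun z => z < y) s.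
  (* One copy of [x] is split off in both counts: it adds 0 to the count for [x] and 1 to the count
     for [y]. *)
  move=> xs xy; have /seq.permP-> := perm_to_rem xs; have /seq.permP-> := perm_to_rem xs.
  rewrite /= ltnn xy add0n add1n ltnS; apply: sub_count => z /= zx.
  exact: ltn_trans xy.
move=> x y xs ys; case: (ltngtP x y) => [/lt_count-> | /lt_count yx | ->] //.
  by apply/negbTE; rewrite -leqNgt ltnW ?yx.
by rewrite ltnn.
Qed.

(** Reduction is injective on the letters, and its [j] distinct values lie below [j], so they
    exhaust [iota 0 j]. *)
Lemma red_word_uniq j s :
  size s = j -> uniq s -> perm_eq (red_word s) (iota 0 j).
Proof.
move=> <- us; rewrite /red_word undup_id //.
set r := map _ s.
have ur : uniq r.
  rewrite map_inj_in_uniq // => x y xs ys eq_xy.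
  case: (ltngtP x y) => //; first by rewrite -(count_ltn_mono xs ys) eq_xy ltnn.
  by rewrite -(count_ltn_mono ys xs) eq_xy ltnn.
have sub_r : {subset r <= iota 0 (size s)}.
  move=> _ /mapP[x xs ->]; rewrite mem_iota add0n /=.
  (* Since [x] is not below itself, at most [size s - 1] letters are counted. *)
  have /seq.permP-> := perm_to_rem xs; rewrite /= ltnn.
  by apply: leq_ltn_trans (count_size _ _) _; rewrite size_rem // ltn_predL; case: s xs {us r ur}.
have [] := uniq_min_size ur sub_r; first by rewrite size_iota size_map.
by move=> _; apply: uniq_perm; rewrite ?iota_uniq.
Qed.

(** The reduced word is a rearrangement of [iota 0 j] that is still increasing, and a strictly
    sorted list is determined by its elements. *)
Lemma red_word_increasing j s :
  size s = j -> pairwise ltn s -> red_word s = iota 0 j.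
Proof.
move=> sj s_inc; have us := pairwise_uniq ltnn s_inc.
apply: (irr_sorted_eq ltn_trans ltnn); last 2 first.
- exact: iota_ltn_sorted.
- exact: perm_mem (red_word_uniq sj us).
rewrite (sorted_pairwise ltn_trans) /red_word undup_id // pairwise_map.
apply: (sub_in_pairwise (P := mem s)) s_inc; last exact/allP.
by move=> x y xs ys /=; rewrite count_ltn_mono.
Qed.

(** Plain sequences of positions suffice, because matching [p.1] already forces their number; this
    avoids tuples of dependent length. *)
Lemma bi_occursP k n (p : pattern) (x : colored_perm k n) :
  reflect (exists i : seq 'I_n,
             [/\ sorted ltn [seq val l | l <- i],
                 red_perm [seq letter x.1 l | l <- i] = p.1
               & red_word [seq val (tnth x.2 l) | l <- i] = p.2])
          (bi_occurs p x).
Proof.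
apply: (iffP existsP) => [[i /and3P[i_inc /eqP ? /eqP ?]] | [i [i_inc ip1 ip2]]].
  by exists i.
have sz_i : size i == size p.1 by rewrite -ip1 size_red_perm size_map.
by exists (Tuple sz_i); rewrite /increasing /= i_inc ip1 ip2 !eqxx.
Qed.

Lemma avoidsPn j n (U : {set 'S_j}) (s : 'S_n) :
  reflect (exists2 t, t \in U & exists2 i : seq 'I_n,
             sorted ltn [seq val l | l <- i]
             & red_perm [seq letter s l | l <- i] = oneline t)
          (~~ avoids U s).
Proof.
rewrite negbK; apply: (iffP existsP) => [[i /andP[i_inc]] | [t tU [i i_inc it]]].
  by case/imageP=> t tU it; exists t => //; exists i.
have sz_i : size i == j by rewrite -(size_oneline t) -it size_red_perm size_map.
by exists (Tuple sz_i); rewrite /increasing /= i_inc it; apply/imageP; exists t.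
Qed.

(** Wherever some [t] in [U] occurs, the reduced subword at the same positions is some [u] in [V],
    so the lift [(oneline t, u)] occurs there. *)
Lemma bi_avoids_lift j k n (U : {set 'S_j}) (V : seq (seq nat))
    (x : colored_perm k n) :
    (forall i : seq 'I_n, size i = j -> sorted ltn [seq val l | l <- i] ->
       red_word [seq val (tnth x.2 l) | l <- i] \in V) ->
  bi_avoids [seq (oneline t, u) | t <- enum U, u <- V] x = avoids U x.1.
Proof.
move=> x2V; apply/negb_inj; rewrite -has_predC.
apply/hasP/avoidsPn => [[p /allpairsP[[t u] /= [tU uV ->]]] | [t tU [i i_inc it]]].
  rewrite /= negbK => /bi_occursP[i [i_inc it iu]].
  by exists t; [rewrite mem_enum in tU | exists i].
have sz_i : size i = j by rewrite -(size_oneline t) -it size_red_perm size_map.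
exists (oneline t, red_word [seq val (tnth x.2 l) | l <- i]).
  by apply: allpairs_f; rewrite ?mem_enum ?x2V.
by rewrite /= negbK; apply/bi_occursP; exists i.
Qed.

Lemma bi_avoids_pairs k n (e : rel 'I_k) (V : seq (seq nat))
    (x : colored_perm k n) :
    (forall a b : 'I_k, e a b = (red_word [:: val a; val b] \notin V)) ->
  bi_avoids [seq (t, u) | t <- [:: [:: 1; 2]; [:: 2; 1]], u <- V] x
    = pairwise e x.2.
Proof.
move=> eV; apply/idP/tnth_pairwiseP => [/allP x_av a b ab | x_e].
  (* The pair of reductions read at positions [a < b] is itself one of the forbidden patterns. *)
  rewrite eV; apply/negP => abV.
  have s_ab : letter x.1 a != letter x.1 b.
    by rewrite eqSS val_eqE (inj_eq perm_inj) neq_ltn ab.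
  have /x_av/bi_occursP[] : (red_perm [:: letter x.1 a; letter x.1 b],
      red_word [:: val (tnth x.2 a); val (tnth x.2 b)]) \in
      [seq (t, u) | t <- [:: [:: 1; 2]; [:: 2; 1]], u <- V].
    by apply: allpairs_f => //; rewrite red_perm_pair //; case: ifP.
  by exists [:: a; b]; rewrite /= ab.
apply/allP => _ /allpairsP[[t u] /= [t12 uV ->]].
apply/bi_occursP => -[i [i_inc /= it iu]].
have: size i = 2.
  rewrite -(size_map (letter x.1)) -size_red_perm it.
  by move: t12; rewrite !inE => /orP[] /eqP->.
case: i => [|a [|b []]] //= in i_inc it iu *; rewrite andbT in i_inc.
by move=> _; have := x_e a b i_inc; rewrite eV iu uV.
Qed.

(** The two-letter patterns amount to [pairwise e w]; this property passes to subwords, so the lifts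
    then constrain [s] alone and the set is a Cartesian product. *)
Lemma Av_col_prod j k n (U : {set 'S_j}) (V W : seq (seq nat)) (e : rel 'I_k)
    (G : seq pattern) :
    G = [seq (oneline t, u) | t <- enum U, u <- V]
          ++ [seq (t, u) | t <- [:: [:: 1; 2]; [:: 2; 1]], u <- W] ->
    (forall a b : 'I_k, e a b = (red_word [:: val a; val b] \notin W)) ->
    (forall s : seq 'I_k, size s = j -> pairwise e s ->
       red_word [seq val a | a <- s] \in V) ->
  Av_col n k G = #|[set w : n.-tuple 'I_k | pairwise e w]| * Av_perm n U.
Proof.
move=> -> eW eV; rewrite mulnC -cardsX; apply: eq_card => -[s w].
rewrite !inE /bi_avoids all_cat -!/(bi_avoids _ (s, w)) (bi_avoids_pairs _ eW).
rewrite [RHS]/=; apply/andP/andP => -[s_av w_e]; split=> //.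
  rewrite -(@bi_avoids_lift _ _ _ U V (s, w)) // => i sz_i i_inc /=.
  by rewrite (map_comp val) eV ?size_map // pairwise_subword.
rewrite (@bi_avoids_lift _ _ _ U V (s, w)) // => i sz_i i_inc /=.
by rewrite (map_comp val) eV ?size_map // pairwise_subword.
Qed.

(** Positive length makes the map from a letter to its constant tuple injective; in length 0 there
    is just the empty tuple. *)
Lemma card_constant_tuples (T : finType) n : 0 < n ->
  #|[set t : n.-tuple T | pairwise eq_op t]| = #|T|.
Proof.
case: n => // n _; rewrite -(card_imset predT (f := fun c : T => [tuple of nseq n.+1 c])).
  apply: eq_card => t; rewrite inE; apply/idP/imsetP => [|[c _ ->]].
    case: t => -[|c s] //= szt /pairwise_eq_nseq s_c.
    by exists c => //; apply: val_inj; rewrite /= s_c; case/eqP: szt => ->.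
  by apply/tnth_pairwiseP => a b _; rewrite !(tnth_nth c) !nth_nseq !ltn_ord.
by move=> c d /(congr1 val) [].
Qed.

Theorem theorem6 (j : nat) (hj : 1 <= j) (U : {set 'S_j})
    (k n : nat) (hk : 1 <= k) (hn : 1 <= n) :
  [/\ Av_col n k (Gamma1 U) = k * Av_perm n U,
      Av_col n k (Gamma2 U) = 'C(k, n) * Av_perm n U
    & Av_col n k (Gamma3 U) = 'C(k, n) * n`! * Av_perm n U].
Proof.
have lift1 (v : seq nat) : [seq (oneline t, v) | t in U] =
    [seq (oneline t, u) | t <- enum U, u <- [:: v]].
  by rewrite /image_mem; elim: (enum U) => //= t s ->.
split.
- rewrite (@Av_col_prod j _ _ U [:: nseq j 0] [:: [:: 0; 1]; [:: 1; 0]] eq_op).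
  + by rewrite card_constant_tuples // card_ord.
  + by rewrite /Gamma1 /lift_zero lift1.
  + by move=> a b; rewrite red_word_pair -val_eqE /= !inE; case: ltngtP.
  move=> s sj s_e; rewrite inE (@red_word_const j) ?size_map //.
  by rewrite pairwise_map.
(* Only the word 01 remains allowed, so [w] is strictly increasing and amounts to an [n]-subset of
   the [k] letters. *)
- rewrite (@Av_col_prod j _ _ U [:: iota 0 j] [:: [:: 1; 0]; [:: 0; 0]]
             (relpre val ltn)).
  + rewrite -card_ltn_sorted_tuples; congr (_ * _); apply: eq_card => w.
    by rewrite !inE increasing_pairwise.
  + by rewrite /Gamma2 /lift_inc lift1.
  + by move=> a b; rewrite red_word_pair /= !inE; case: ltngtP.
  move=> s sj s_e; rewrite inE (@red_word_increasing j) ?size_map //.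
  by rewrite pairwise_map.
rewrite (@Av_col_prod j _ _ U (permutations (iota 0 j)) [:: [:: 0; 0]]
           [rel a b | a != b]) //.
(* Words without repeated letters are counted by the falling factorial [k ^_ n]. *)
- rewrite bin_ffact; congr (_ * _).
  rewrite -[k in RHS]card_ord -card_uniq_tuples.
  by apply: eq_card => w; rewrite !inE all_predT uniq_pairwise.
- by move=> a b /=; rewrite red_word_pair -val_eqE /= !inE; case: ltngtP.
move=> s sj; rewrite -uniq_pairwise mem_permutations => us.
by rewrite (@red_word_uniq j) ?size_map // (map_inj_uniq val_inj).
Qed.
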